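(* Let $B$ be a unital C*-algebra, let $A\subseteq B$ be a C*-subalgebra which is a unital C*-algebra, and let $P\colon B\to A$ be a conditional expectation from $B$ onto $A$. The following conditions are equivalent: (1) for every proper ideal $J$ of $B$, the ideal $\overline{P(J)}$ of $A$ is proper; (2) every maximal ideal of $B$ is induced from a maximal ideal of $A$, i.e. for every maximal ideal $J$ of $B$ there is a maximal ideal $I$ of $A$ with $J=\mathrm{Ind}_P(I)$; (3) the map $I\mapsto \mathrm{Ind}_P(I)$ defines a bijection between the set of maximal co-induced ideals of $A$ and the set of maximal ideals of $B$.
   Context: ''Ideal'' of a C*-algebra means closed two-sided ideal; ''maximal ideal'' means maximal among proper ideals. A conditional expectation $P\colon B\to A$ onto a C*-subalgebra $A$ is a contractive (completely) positive $A$-bimodule projection onto $A$. For an ideal $I$ of $A$, the ideal of $B$ induced from $I$ via $P$ is $\mathrm{Ind}_P(I)=\{b\in B: P(xby)\in I\text{ for all }x,y\in B\}$. For an ideal $J$ of $B$, the ideal of $A$ co-induced from $J$ via $P$ is $\mathrm{Coind}_P(J)=\overline{P(J)}$ (norm closure). An ideal of $A$ is called co-induced if it equals $\mathrm{Coind}_P(J)$ for some ideal $J$ of $B$. A maximal co-induced ideal of $A$ is a proper co-induced ideal that is maximal, with respect to inclusion, among proper co-induced ideals of $A$. *)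

(* Defs.v *)
From HB Require Import structures.
From mathcomp Require Import all_boot all_order all_algebra.
From mathcomp Require Import complex.
From mathcomp Require Import all_classical all_reals all_analysis.

Set Implicit Arguments.
Unset Strict Implicit.
Unset Printing Implicit Defensive.

Import Order.TTheory GRing.Theory Num.Theory.
Import numFieldNormedType.Exports.

Local Open Scope classical_set_scope.
Local Open Scope ring_scope.
Local Open Scope complex_scope.

Reserved Notation "x ** y" (at level 40, left associativity).

(* Ring product and unit are fields of this mixin, because Hierarchy Builder
   admits no join of pzRingType with normed modules (numDomainType already
   inherits from both).  The trivial algebra, where the unit is 0, is allowed.
   Norms take their values in R[i]; they are nonnegative there, hence real. *)
HB.mixin Record isCStarAlgebra (R : realType) B
    of CompleteNormedModule R[i] B := {
  cmul : B -> B -> B;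
  cunit : B;
  star : B -> B;
  cmulA : associative cmul;
  cmul1l : left_id cunit cmul;
  cmul1r : right_id cunit cmul;
  cmulDl : left_distributive cmul +%R;
  cmulDr : right_distributive cmul +%R;
  cmulZl : forall (k : R[i]) x y, cmul (k *: x) y = k *: cmul x y;
  cmulZr : forall (k : R[i]) x y, cmul x (k *: y) = k *: cmul x y;
  norm_cmul : forall x y, `|cmul x y| <= `|x| * `|y|;
  starK : involutive star;
  starD : {morph star : x y / x + y};
  starZ : forall (k : R[i]) x, star (k *: x) = conjc k *: star x;
  starM : forall x y, star (cmul x y) = cmul (star y) (star x);
  norm_starM : forall x, `|cmul (star x) x| = `|x| ^+ 2
}.

#[short(type="cstarAlgType")]
HB.structure Definition CStarAlgebra (R : realType) :=
  {B of CompleteNormedModule R[i] B & isCStarAlgebra R B}.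

Local Notation "x ** y" := (cmul x y) : ring_scope.

Section CStar.
Variables (R : realType) (B : cstarAlgType R).
Implicit Types (A I J : set B) (P : B -> B).

Definition subspace A :=
  [/\ A 0, forall x y, A x -> A y -> A (x + y) &
      forall (k : R[i]) x, A x -> A (k *: x)].

Definition cstar_subalgebra A :=
  [/\ closed A, subspace A, forall x y, A x -> A y -> A (x ** y) &
      forall x, A x -> A (star x)].

(* The unit of A is not required to be the unit of B. *)
Definition unital A :=
  exists2 e, A e & forall a, A a -> e ** a = a /\ a ** e = a.

Definition positive_in A (x : B) := exists2 c, A c & x = star c ** c.

(* Only positivity is required: a contractive projection onto a C*-subalgebra
   is automatically completely positive (Tomiyama). *)
Definition conditional_expectation A P :=
  [/\ linear P /\ (forall b, `|P b| <= `|b|),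
      forall x, positive_in setT x -> positive_in A (P x),
      (forall b, A (P b)) /\ (forall a, A a -> P a = a) &
      forall a b, A a -> P (a ** b) = a ** P b /\ P (b ** a) = P b ** a].

(* Ideals of B itself are the case A := setT. *)
Definition closed_ideal A I :=
  [/\ I `<=` A, closed I, subspace I &
      forall a x, A a -> I x -> I (a ** x) /\ I (x ** a)].

Definition proper_closed_ideal A I := closed_ideal A I /\ I <> A.

Definition maximal_closed_ideal A I :=
  proper_closed_ideal A I /\
  forall I', proper_closed_ideal A I' -> I `<=` I' -> I' = I.

Definition Ind P I : set B := [set b | forall x y, I (P (x ** b ** y))].

(* As A is closed in B, the closure in B of a subset of A is its closure in A. *)
Definition Coind P J : set B := closure (P @` J).

Definition coinduced_ideal A P I :=
  closed_ideal A I /\ exists2 J, closed_ideal setT J & I = Coind P J.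

Definition proper_coinduced_ideal A P I := coinduced_ideal A P I /\ I <> A.

Definition maximal_coinduced_ideal A P I :=
  proper_coinduced_ideal A P I /\
  forall I', proper_coinduced_ideal A P I' -> I `<=` I' -> I' = I.

End CStar.

(* Main.v *)
Require Import Defs.
From mathcomp Require Import all_boot all_order all_algebra.
From mathcomp Require Import complex.
From mathcomp Require Import all_classical all_reals all_analysis.

Local Open Scope classical_set_scope.

(** Induction and co-induction are adjoint: a closed ideal [J] of [B] lies in
    [Ind P I] exactly when [Coind P J] lies in [I].  Both sides say that [P]
    maps [J] into [I], because [J] is stable under multiplication by [B] and
    [I] is closed ([Coind_Ind_adjoint]).  Moreover [P] sends the unit of [B] to
    the unit of [A], so [Ind P I] is proper as soon as [I] is.

    These two facts and the existence of maximal ideals give everything.  The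
    key remark is that if [J] is maximal and [I] is a proper ideal of [A]
    containing [Coind P J], then the proper ideal [Ind P I] contains [J], hence
    equals it ([maximal_eq_Ind]).
    - If proper ideals have proper co-inductions, the remark applies to a
      maximal ideal [I] above [Coind P J], and to [Coind P J] itself.  The
      latter makes [Coind] the inverse of [Ind] between maximal ideals of [B]
      and maximal co-induced ideals of [A].
    - Conversely, suppose that every maximal ideal of [B] has the form
      [Ind P I] with [I] proper.  A proper ideal [J] of [B] lies in such an
      [Ind P I], so [Coind P J] lies in [I] ([Coind_proper_of_Ind]).  This
      handles the last two conditions at once.

    The analytic content is confined to the existence of maximal closed ideals,
    by Zorn's lemma ([exists_maximal_closed_ideal]).  The upper bound of a
    chain is the closure of its union, which must be shown to be proper.  It
    is, because a closed ideal that comes within distance less than 1 of the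
    unit contains the unit ([closed_ideal_unit]). *)

Set Implicit Arguments.
Unset Strict Implicit.
Unset Printing Implicit Defensive.

Import Order.TTheory GRing.Theory Num.Theory.
Import numFieldNormedType.Exports.

Local Open Scope ring_scope.
Local Open Scope complex_scope.

Local Notation "x ** y" := (cmul x y) : ring_scope.

(** * Closures in normed modules *)

Section Closure.
Variables (R : realType) (V : normedModType R[i]).
Implicit Types (I J : set V) (x y : V).

Lemma closure_approxP I x :
  closure I x <-> forall eps : R[i], 0 < eps -> exists2 y, I y & `|x - y| < eps.
Proof.
split=> [Ix eps eps0|Ix U /nbhs_normP [eps eps0 sub]].
  have [|y [Iy /= xy]] := Ix [set y | `|x - y| < eps]; last by exists y.
  by apply/nbhs_normP; exists eps.
by have [y Iy xy] := Ix _ eps0; exists y; split => //; exact: sub.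
Qed.

(** A uniform way to pass closure properties from a set to its closure: [f] will
    be a translation, a scaling, a multiplication or [b |-> P (x b y)]. *)
Lemma closure_lipschitz I J (f : V -> V) (C : R[i]) : 0 <= C ->
  (forall x y, `|f x - f y| <= C * `|x - y|) ->
  (forall x, I x -> closure J (f x)) ->
  forall x, closure I x -> closure J (f x).
Proof.
move=> C0 lipf IJ x /closure_approxP Ix.
have {}C0 : 0 < C + 1 by rewrite ltr_wpDl.
rewrite (closure_id (closure J)).1; last exact: closed_closure.
apply/closure_approxP => eps eps0.
have [|y Iy xy] := Ix (eps / (C + 1)); first by rewrite divr_gt0.
exists (f y); first exact: IJ.
rewrite (le_lt_trans (lipf x y)) //.
rewrite ltr_pdivlMr // mulrC in xy; apply: le_lt_trans xy.
by rewrite ler_wpM2r // lerDl.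
Qed.

End Closure.

(** Comparability with a real number forces the imaginary part to vanish, which
    reduces the claim to the convergence of geometric sequences in [R]. *)
Lemma expr_small (R : realType) (c eps : R[i]) :
  0 <= c < 1 -> 0 < eps -> exists n, c ^+ n < eps.
Proof.
case: c eps => [c c'] [e e'] /andP[].
rewrite lecE ltcE ltcE /= => /andP[/eqP -> c0] /andP[_ c1] /andP[/eqP -> e0].
have /cvgrPdist_lt/(_ _ e0) [N _ small] : (GRing.exp c : R^nat) @ \oo --> 0.
  by apply: cvg_expr; rewrite ger0_norm.
exists N; have /= := small N (leqnn N).
rewrite sub0r normrN ger0_norm ?exprn_ge0 // => cN.
by rewrite -[(c +i* 0) ^+ N](rmorphXn (real_complex R)) ltcR.
Qed.

(** * Closed ideals *)

Section Ideals.
Variables (R : realType) (B : cstarAlgType R).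
Implicit Types (A I J M : set B) (a b x y e : B).

Lemma cmulNl x y : (- x) ** y = - (x ** y).
Proof. by rewrite -scaleN1r cmulZl scaleN1r. Qed.

Lemma cmulNr x y : x ** (- y) = - (x ** y).
Proof. by rewrite -scaleN1r cmulZr scaleN1r. Qed.

Lemma cmulBl x y z : (x - y) ** z = x ** z - y ** z.
Proof. by rewrite cmulDl cmulNl. Qed.

Lemma cmulBr x y z : x ** (y - z) = x ** y - x ** z.
Proof. by rewrite cmulDr cmulNr. Qed.

Lemma subspaceB I x y : Defs.subspace I -> I x -> I y -> I (x - y).
Proof.
by move=> [_ ID IZ] Ix Iy; apply: ID => //; rewrite -scaleN1r; apply: IZ.
Qed.

Definition algebraic_ideal A I :=
  [/\ I `<=` A, Defs.subspace I &
      forall a x, A a -> I x -> I (a ** x) /\ I (x ** a)].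

Lemma closure_algebraic_ideal A I :
  closed A -> algebraic_ideal A I -> closed_ideal A (closure I).
Proof.
move=> clA [IA [I0 ID IZ] IM].
have sub : I `<=` closure I by exact: subset_closure.
have ID' x y : I x -> closure I y -> closure I (x + y).
  move=> Ix; apply: (@closure_lipschitz _ _ I I (fun y => x + y) 1) => //.
    by move=> u v; rewrite mul1r opprD addrACA subrr add0r.
  by move=> u Iu; apply/sub/ID.
split.
- by rewrite (closure_id A).1 //; exact: closureS.
- exact: closed_closure.
- split; first exact: sub.
  + move=> x y Ix Iy; move: x Ix.
    apply: (@closure_lipschitz _ _ I I (fun x => x + y) 1) => //.
      by move=> u v; rewrite mul1r opprD addrACA subrr addr0.
    by move=> u Iu; apply: ID'.
  + move=> k; apply: (@closure_lipschitz _ _ I I (fun x => k *: x) `|k|) => //.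
      by move=> u v; rewrite -scalerBr normrZ.
    by move=> u Iu; apply/sub/IZ.
- move=> a x Aa Ix; split; move: x Ix.
  + apply: (@closure_lipschitz _ _ I I (fun x => a ** x) `|a|) => //.
      by move=> u v; rewrite -cmulBr norm_cmul.
    by move=> u Iu; apply/sub; have [] := IM _ _ Aa Iu.
  + apply: (@closure_lipschitz _ _ I I (fun x => x ** a) `|a|) => //.
      by move=> u v; rewrite -cmulBl mulrC norm_cmul.
    by move=> u Iu; apply/sub; have [] := IM _ _ Aa Iu.
Qed.

Definition is_unit_of A e := A e /\ forall a, A a -> e ** a = a /\ a ** e = a.

Lemma is_unit_setT : is_unit_of setT (cunit : B).
Proof. by split=> // a _; rewrite cmul1l cmul1r. Qed.

Lemma proper_closed_idealP A e I : is_unit_of A e ->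
  proper_closed_ideal A I <-> closed_ideal A I /\ ~ I e.
Proof.
move=> [Ae unit_e]; split=> -[clI ne]; split=> //.
  move=> Ie; case: clI => IA _ _ IM; apply/ne/seteqP; split=> // a Aa.
  by rewrite -(unit_e a Aa).2; have [] := IM _ _ Aa Ie.
by move=> IA; apply: ne; rewrite IA.
Qed.

(** With [d := e - x], the elements [e - d ^ n.+1 = x + d (e - d ^ n)] all lie
    in [I], and they converge to [e] since the norm of [d] is less than 1.  This
    spares the inversion of [x] by a Neumann series. *)
Lemma closed_ideal_unit A e I x : Defs.subspace A -> is_unit_of A e ->
  closed_ideal A I -> I x -> `|e - x| < 1 -> I e.
Proof.
move=> subA [Ae unit_e] [IA clI subI IM] Ix lt1; pose d := e - x.
have Ad : A d by apply: subspaceB => //; exact: IA.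
pose dn n := iter n (cmul d) d.
have Idn n : I (e - dn n).
  elim: n => [|n IH]; first by rewrite /= /d opprB addrC subrK.
  have -> : e - dn n.+1 = x + d ** (e - dn n).
    by rewrite cmulBr (unit_e _ Ad).2 /d /= addrA addrC subrKC addrC.
  by case: subI => _ ID _; apply: ID => //; have [] := IM _ _ Ad IH.
have norm_dn n : `|dn n| <= `|d| ^+ n.+1.
  elim: n => [|n IH]; first by rewrite expr1.
  rewrite [leRHS]exprS; apply: le_trans (norm_cmul _ _) _.
  exact: ler_wpM2l.
rewrite (closure_id I).1 //; apply/closure_approxP => eps eps0.
have [|n small] := @expr_small _ `|d| eps _ eps0.
  by rewrite normr_ge0 lt1.
exists (e - dn n) => //; rewrite subKr.
apply: le_lt_trans small; apply: le_trans (norm_dn n) _.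
by rewrite exprS ler_piMl ?exprn_ge0 // ltW.
Qed.

Lemma exists_maximal_closed_ideal A e I : closed A -> Defs.subspace A ->
  is_unit_of A e -> proper_closed_ideal A I ->
  exists2 M, maximal_closed_ideal A M & I `<=` M.
Proof.
move=> clA subA unit_e propI.
have PP := proper_closed_idealP _ unit_e.
pose above X := proper_closed_ideal A X /\ I `<=` X.
pose T := {X : set B | above X}.
have [||||[M [propM IM]] maxM] :=
    @Zorn T (fun X Y => `[< sval X `<=` sval Y >]).
- by move=> X; apply/asboolP.
- move=> X Y Z /asboolP XY /asboolP YZ; apply/asboolP.
  exact: subset_trans YZ.
- move=> [X PX] [Y PY] /asboolP /= XY /asboolP /= YX.
  by apply: eq_exist; apply/seteqP.
- move=> F totF; have [[X0 FX0]|F0] := pselect (exists X, F X); last first.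
    exists (exist above I (conj propI (@subset_refl _ I))) => X FX.
    by case: F0; exists X.
  pose U := \bigcup_(X in F) sval X.
  have idU : algebraic_ideal A U.
    split.
    + by move=> x [X _ Xx]; case: (svalP X) => -[[XA _ _ _] _] _; exact: XA.
    + split.
      * by exists X0 => //; case: (svalP X0) => -[[_ _ [X00 _ _] _] _] _.
      * move=> x y [X FX Xx] [Y FY Yy].
        have [/asboolP XY|/asboolP YX] := totF _ _ FX FY.
          exists Y => //; case: (svalP Y) => -[[_ _ [_ YD _] _] _] _.
          by apply: YD => //; exact: XY.
        exists X => //; case: (svalP X) => -[[_ _ [_ XD _] _] _] _.
        by apply: XD => //; exact: YX.
      * move=> k x [X FX Xx]; exists X => //.
        by case: (svalP X) => -[[_ _ [_ _ XZ] _] _] _; exact: XZ.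
    + move=> a x Aa [X FX Xx]; case: (svalP X) => -[[_ _ _ XM] _] _.
      by have [] := XM _ _ Aa Xx; split; exists X.
  (* The closure stays proper: were the unit in it, some member of the chain
     would come within distance 1 of the unit, hence contain it. *)
  have propU : proper_closed_ideal A (closure U).
    apply/PP; split; first exact: closure_algebraic_ideal.
    move=> /closure_approxP /(_ 1 ltr01) [x [X _ Xx] lt1].
    have [/PP[clX Xe] _] := svalP X.
    by apply: Xe; exact: closed_ideal_unit subA unit_e clX Xx lt1.
  have sU X : F X -> sval X `<=` closure U.
    by move=> FX x Xx; apply: subset_closure; exists X.
  have IU : I `<=` closure U.
    by apply: subset_trans (sU _ FX0); case: (svalP X0).
  by exists (exist above _ (conj propU IU)) => X FX; apply/asboolP; exact: sU.
exists M => //; split=> // X propX MX.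
have := maxM (exist above X (conj propX (subset_trans IM MX))).
by move=> /(_ (asboolT MX)) [].
Qed.

(** * Induction and co-induction along a conditional expectation *)

Section Expectation.
Variables (A : set B) (P : B -> B) (e : B).
Hypotheses (subA : cstar_subalgebra A) (unit_e : is_unit_of A e).
Hypothesis condP : conditional_expectation A P.

Lemma expectationB x y : P (x - y) = P x - P y.
Proof.
case: condP => -[linP _] _ _ _.
by rewrite addrC -scaleN1r linP scaleN1r addrC.
Qed.

Lemma expectation0 : P 0 = 0.
Proof. by rewrite -[X in P X](subrr 0) expectationB subrr. Qed.

Lemma expectation_unit : P cunit = e.
Proof.
have [_ unit_eP] := unit_e; case: condP => _ _ [PA PK] PM.
rewrite -(unit_eP _ (PA _)).1 -(PM _ _ unit_e.1).1 cmul1r.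
exact: PK unit_e.1.
Qed.

Lemma Coind_closed_ideal J :
  closed_ideal setT J -> closed_ideal A (Coind P J).
Proof.
case: subA => clA _ _ _; case: condP => -[linP _] _ [PA PK] PM.
move=> [_ _ [J0 JD JZ] JM]; apply: closure_algebraic_ideal => //; split.
- by move=> _ [x _ <-].
- split; first by exists 0 => //; exact: expectation0.
  + move=> _ _ [x Jx <-] [y Jy <-]; exists (x + y); first exact: JD.
    by rewrite -[x]scale1r linP !scale1r.
  + move=> k _ [x Jx <-]; exists (k *: x); first exact: JZ.
    by rewrite -[k *: x]addr0 linP expectation0 addr0.
- move=> a _ Aa [x Jx <-]; have [Jax Jxa] := JM a x Logic.I Jx.
  by have [<- <-] := PM a x Aa; split; [exists (a ** x)|exists (x ** a)].
Qed.

Lemma Ind_proper_closed_ideal I :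
  proper_closed_ideal A I -> proper_closed_ideal setT (Ind P I).
Proof.
move=> /(proper_closed_idealP _ unit_e)[[_ clI [I0 ID IZ] _] Ie].
case: condP => -[linP contrP] _ _ _.
apply/(proper_closed_idealP _ is_unit_setT); split; last first.
  by move=> /(_ cunit cunit); rewrite cmul1l cmul1r expectation_unit.
split=> //.
- rewrite closure_id; apply/seteqP; split; first exact: subset_closure.
  move=> b Ib x y; rewrite (closure_id I).1 //; move: b Ib.
  apply: (@closure_lipschitz _ _ _ _ (fun b => P (x ** b ** y)) (`|x| * `|y|)).
  + by rewrite mulr_ge0.
  + move=> b b'; rewrite -expectationB -cmulBl -cmulBr.
    rewrite (le_trans (contrP _)) // (le_trans (norm_cmul _ _)) // mulrAC.
    by rewrite ler_wpM2r // norm_cmul.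
  + by move=> b Ib; apply: subset_closure; exact: Ib.
- split.
  + move=> x y; rewrite -(scale0r (0 : B)) cmulZr cmulZl !scale0r expectation0.
    exact: I0.
  + move=> b b' Ib Ib' x y.
    by rewrite cmulDr cmulDl -[x ** b ** y]scale1r linP scale1r; exact: ID.
  + move=> k b Ib x y.
    by rewrite cmulZr cmulZl -[k *: _]addr0 linP expectation0 addr0; exact: IZ.
- move=> a b _ Ib; split=> x y; first by rewrite cmulA; exact: Ib.
  by rewrite cmulA -(cmulA (x ** b)); exact: Ib.
Qed.

(** From left to right: [P] maps [x b y] into [Coind P J] for every [b]
    in [J], since [J] is two-sided. *)
Lemma Coind_Ind_adjoint I J : closed I -> closed_ideal setT J ->
  Coind P J `<=` I <-> J `<=` Ind P I.
Proof.
move=> clI [_ _ _ JM]; split=> sub.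
  move=> b Jb x y; apply/sub/subset_closure; exists (x ** b ** y) => //.
  by have [_] := JM y _ Logic.I (JM x b Logic.I Jb).1.
rewrite (closure_id I).1 //; apply: closureS => _ [b Jb <-].
by have := sub b Jb cunit cunit; rewrite cmul1l cmul1r.
Qed.

Lemma maximal_eq_Ind I J : maximal_closed_ideal setT J ->
  proper_closed_ideal A I -> Coind P J `<=` I -> J = Ind P I.
Proof.
move=> [[idJ _] maxJ] propI JI; have [[_ clI _ _] _] := propI.
rewrite (maxJ (Ind P I)) //; first exact: Ind_proper_closed_ideal.
exact/Coind_Ind_adjoint.
Qed.

Lemma exists_maximal_closed_ideal_setT J : proper_closed_ideal setT J ->
  exists2 M, maximal_closed_ideal setT M & J `<=` M.
Proof. exact: exists_maximal_closed_ideal closedT _ is_unit_setT. Qed.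

(** Only properness of [I] is assumed, so that the lemma applies both to maximal
    ideals of [A] and to maximal co-induced ones. *)
Lemma Coind_proper_of_Ind :
  (forall J, maximal_closed_ideal setT J ->
    exists2 I, proper_closed_ideal A I & J = Ind P I) ->
  forall J, proper_closed_ideal setT J -> proper_closed_ideal A (Coind P J).
Proof.
move=> maxInd J propJ.
have [M maxM JM] := exists_maximal_closed_ideal_setT propJ.
have [I propI MI] := maxInd M maxM; case: propJ => idJ _.
have /(proper_closed_idealP _ unit_e)[[_ clI _ _] Ie] := propI.
apply/(proper_closed_idealP _ unit_e); split; first exact: Coind_closed_ideal.
by move=> Je; apply: Ie; apply: (Coind_Ind_adjoint clI idJ).2 Je; rewrite -MI.
Qed.

Section ProperCoinduction.
Hypothesis Coind_proper : forall J,
  proper_closed_ideal setT J -> proper_closed_ideal A (Coind P J).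

(** A proper co-induced ideal [I = Coind P J'] above [Coind P J] need not come
    from an ideal [J'] above [J].  But [J = Ind P I] by maximality of [J], and
    [Ind P I] contains [J'] by adjunction; so [I] is contained in
    [Coind P J]. *)
Lemma Coind_maximal J : maximal_closed_ideal setT J ->
  maximal_coinduced_ideal A P (Coind P J).
Proof.
move=> maxJ; have [propJ _] := maxJ.
have [idPJ nePJ] := Coind_proper propJ.
split; first by do 2?split=> //; exists J => //; case: propJ.
move=> I [[idI [J' idJ' IJ']] neI] JI.
apply/seteqP; split=> //; rewrite [X in X `<=` _]IJ'; apply: closureS.
apply: image_subset; rewrite (maximal_eq_Ind maxJ _ JI) //.
by case: (idI) => _ clI _ _; apply/Coind_Ind_adjoint => //; rewrite -IJ'.
Qed.

(** If the maximal co-induced ideal [I] is co-induced from [J], it is also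
    co-induced from any maximal ideal above [J]. *)
Lemma maximal_coinduced_Coind I : maximal_coinduced_ideal A P I ->
  exists2 J, maximal_closed_ideal setT J & I = Coind P J.
Proof.
move=> [[[idI [J idJ IJ]] neI] maxI].
have propJ : proper_closed_ideal setT J.
  split=> // JT; apply/neI/seteqP; split; first by case: idI.
  case: condP => _ _ [_ PK] _ a Aa; rewrite IJ JT.
  by apply: subset_closure; exists a => //; exact: PK.
have [M maxM JM] := exists_maximal_closed_ideal_setT propJ.
exists M => //; have [propPM _] := Coind_maximal maxM.
by apply/esym/maxI => //; rewrite IJ; apply: closureS; exact: image_subset.
Qed.

Lemma Ind_Coind_maximal J : maximal_closed_ideal setT J ->
  Ind P (Coind P J) = J.
Proof.
move=> maxJ; apply/esym/maximal_eq_Ind => //.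
by case: maxJ => propJ _; exact: Coind_proper.
Qed.

Lemma Ind_bij : set_bij [set I | maximal_coinduced_ideal A P I]
  [set J | maximal_closed_ideal setT J] (Ind P).
Proof.
split.
- by move=> _ /maximal_coinduced_Coind[J maxJ ->] /=; rewrite Ind_Coind_maximal.
- move=> I I'; rewrite !inE => /maximal_coinduced_Coind[J maxJ ->].
  move=> /maximal_coinduced_Coind[J' maxJ' ->].
  by rewrite !Ind_Coind_maximal // => ->.
- move=> J maxJ; exists (Coind P J); first exact: Coind_maximal.
  exact: Ind_Coind_maximal.
Qed.

End ProperCoinduction.
End Expectation.
End Ideals.

Theorem theorem1p1 (R : realType) (B : cstarAlgType R) (A : set B) (P : B -> B)
    (subA : cstar_subalgebra A) (unitA : unital A)
    (condP : conditional_expectation A P) :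
  let cond1 := forall J : set B,
    proper_closed_ideal setT J -> proper_closed_ideal A (Coind P J) in
  let cond2 := forall J : set B, maximal_closed_ideal setT J ->
    exists2 I : set B, maximal_closed_ideal A I & J = Ind P I in
  let cond3 := set_bij [set I : set B | maximal_coinduced_ideal A P I]
    [set J : set B | maximal_closed_ideal setT J] (Ind P) in
  (cond1 <-> cond2) /\ (cond2 <-> cond3).
Proof.
move=> cond1 cond2 cond3; case: unitA => e Ae unit_eP.
have unit_e : is_unit_of A e by [].
have c12 : cond1 -> cond2.
  move=> c1 J maxJ; have [propJ _] := maxJ.
  have [clA spA _ _] := subA.
  have [I maxI JI] := exists_maximal_closed_ideal clA spA unit_e (c1 J propJ).
  by exists I => //; apply: (maximal_eq_Ind unit_e condP) => //; case: maxI.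
have c21 : cond2 -> cond1.
  move=> c2; apply: (Coind_proper_of_Ind subA unit_e condP) => J.
  move=> /c2[I [propI _]].
  by exists I.
have c13 : cond1 -> cond3 by exact: Ind_bij unit_e condP.
have c31 : cond3 -> cond1.
  move=> [_ _ surjP]; apply: (Coind_proper_of_Ind subA unit_e condP) => J maxJ.
  have [I [[[idI _] neI] _] IJ] := surjP J maxJ.
  by exists I.
by split; split=> // c; [apply/c13/c21|apply/c12/c31].
Qed.
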